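(* Let $d\ge 2$ be fixed. There is an infinite set $\mathbb{E}$ of positive integers such that $$\lim_{k\to\infty}\frac{|\mathbb{E}\cap[1,k]|}{k^{1/(d-1)}}=0,$$ such that $\delta_z(d,k)=\lfloor\lambda(d,k)\rfloor$ for every positive integer $k\notin\mathbb{E}$, and $\delta_z(d,k)=\lfloor\lambda(d,k)\rfloor-1$ for every $k\in\mathbb{E}$.
   Context: A point of $\mathbb{Z}^d$ is primitive if its coordinates are relatively prime; $\mathbb{P}^d_\circ$ denotes the set of primitive points of $\mathbb{Z}^d$ whose first non-zero coordinate is positive. For a finite $\mathcal{X}\subset\mathbb{R}^d$, $\kappa(\mathcal{X})=\max_{1\le i\le d}\sum_{x\in\mathcal{X}}|x_i|$. For a positive integer $k$, $\delta_z(d,k)=\max\{|\mathcal{X}|:\mathcal{X}\subset\mathbb{P}^d_\circ,\ \kappa(\mathcal{X})\le k\}$. Let $B(d,p)=\{x\in\mathbb{R}^d:\|x\|_1\le p\}$, and for integers $p\ge 0$ let $N_p=|B(d,p)\cap\mathbb{P}^d_\circ|$ and $\kappa_p=\kappa(B(d,p)\cap\mathbb{P}^d_\circ)$ (so $N_0=\kappa_0=0$). For a positive integer $k$, let $p$ be the smallest positive integer with $k<\kappa_p$ and set $\lambda(d,k)=N_{p-1}+\frac{d\,(k-\kappa_{p-1})}{p}$; this is the piecewise-linear interpolation of the points $(\kappa_p,N_p)$. *)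

(* Defs.v *)
From mathcomp Require Import all_boot all_order all_algebra.
From Stdlib Require Reals.
From Coquelicot Require Coquelicot.

Set Implicit Arguments.
Unset Strict Implicit.
Unset Printing Implicit Defensive.

Import Order.TTheory GRing.Theory Num.Theory.

Definition point (d : nat) := {ffun 'I_d -> int}.

Definition primitive (d : nat) (x : point d) : bool :=
  (\big[gcdn/0%N]_(i < d) `|x i|%N) == 1%N.

Definition first_nonzero_pos (d : nat) (x : point d) : bool :=
  [exists i : 'I_d, (0 < x i)%R && [forall j : 'I_d, (j < i)%N ==> (x j == 0%R)]].

Definition in_Pdo (d : nat) (x : point d) : bool :=
  primitive x && first_nonzero_pos x.

Definition kappa (d : nat) (X : seq (point d)) : nat :=
  \max_(i < d) \sum_(x <- X) `|x i|%N.

Definition admissible (d k : nat) (X : seq (point d)) : Prop :=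
  [/\ uniq X, all (@in_Pdo d) X & (kappa X <= k)%N].
Arguments admissible : clear implicits.

Definition is_delta_z (d k m : nat) : Prop :=
  (exists2 X, admissible d k X & size X = m) /\
  (forall X, admissible d k X -> (size X <= m)%N).

Definition l1 (d : nat) (x : point d) : nat := \sum_(i < d) `|x i|%N.

Definition box (d p : nat) : seq (point d) :=
  [seq [ffun i => ((f i : nat)%:Z - p%:Z)%R] | f : {ffun 'I_d -> 'I_(p + p).+1}].

Definition BP (d p : nat) : seq (point d) :=
  [seq x <- box d p | (l1 x <= p)%N && in_Pdo x].

Definition N_ (d p : nat) : nat := size (BP d p).
Definition kappa_ (d p : nat) : nat := kappa (BP d p).

(* p(d,k): smallest positive integer p with k < kappa_p.  For d >= 2 it lies in
   [1, k+1] (the points (1,j,0,...,0), 0 <= j <= k, lie in B(d,k+1) ∩ P^d_o and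
   give kappa_{k+1} >= k+1), so searching 1..k+1 finds it. *)
Definition p_ (d k : nat) : nat :=
  (find (fun p => k < kappa_ d p)%N (iota 1 k.+1)).+1.

Definition lambda (d k : nat) : rat :=
  let p := p_ d k in
  ((N_ d p.-1)%:R + (d%:R * (k%:R - (kappa_ d p.-1)%:R)) / p%:R)%R.

Definition countE (E : pred nat) (k : nat) : nat := count E (iota 1 k).

Definition sparse (d : nat) (E : pred nat) : Prop :=
  Lim_seq.is_lim_seq
    (fun k : nat => Rdefinitions.Rdiv (Raxioms.INR (countE E k))
        (Rpower.Rpower (Raxioms.INR k) (Rdefinitions.Rinv (Raxioms.INR (d - 1)))))
    (Rbar.Finite Rdefinitions.R0).

(* Main.v *)
Require Import Defs.
From mathcomp Require Import all_boot all_order all_algebra.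
From mathcomp Require Import zify.
From Stdlib Require Reals ClassicalEpsilon.
From Coquelicot Require Coquelicot.

(** Among sets of [m] points of P^d_o, the total l1 norm is least when the points are
  taken by increasing norm, and a set with [kappa <= k] has total norm at most [d k];
  this gives the upper bound [floor (lambda d k)].  For the lower bound take the ball
  of radius [q = p - 1] and [s] points of norm [p], where [s <= d (k - kappa_q) / p];
  what is needed is that these [s] points be balanced, that is, that all their
  coordinate sums be close to [s p / d].  Sets stable under the cyclic shift of
  coordinates (points being taken up to sign) are perfectly balanced, and they can be
  found with any prescribed size up to an error less than [d].  The error is
  corrected inside one fixed stable family of near-constant points:
  - if [d] does not divide [p], rotations of a step function, chosen at evenly spread
    positions, achieve the ceiling of [s p / d], so there are no exceptions;
  - if [p = d m], points [m + c e_a - c e_b] lose at most [c <= m] per coordinate, which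
    costs at most one point.  When [d > 2] and [c = 1], closed trails of transfers
    [(a, b)] give exact balance unless [s = 1] or [s] is within [d^2] of the size of the
    layer.
  So for [d > 2] there are boundedly many exceptions per layer, and they are sparse
  because [kappa_p] grows at least like [p^d].  For [d = 2] an exception [k] satisfies
  [floor (lambda (k - 2)) < floor (lambda k)], and [lambda] is sublinear.
  Finally [k = kappa_q + j] with [q + 1 = d j], [j > 1], is always exceptional: the only
  candidate for the extra point has all coordinates equal to [j] in absolute value. *)

Set Implicit Arguments.
Unset Strict Implicit.
Unset Printing Implicit Defensive.

Import Order.TTheory GRing.Theory Num.Theory.

(** * Coordinate sums and layers *)

Definition csum (d : nat) (i : 'I_d) (X : seq (point d)) : nat :=
  \sum_(x <- X) `|x i|%N.

Definition layer (d p : nat) : seq (point d) := [seq x <- BP d p | l1 x == p].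

Lemma leq_coord_l1 (d : nat) (x : point d) (i : 'I_d) : `|x i|%N <= l1 x.
Proof. by rewrite /l1 (bigD1 i) //= leq_addr. Qed.

Lemma mem_BP (d p : nat) (x : point d) : (x \in BP d p) = (l1 x <= p) && in_Pdo x.
Proof.
rewrite mem_filter; case: (boolP ((l1 x <= p) && in_Pdo x)) => //= /andP[hx _].
pose f : {ffun 'I_d -> 'I_(p + p).+1} := [ffun i => inord `|(x i + p%:Z)%R|%N].
apply/mapP; exists f; first by rewrite mem_enum.
apply/ffunP => i; rewrite !ffunE; have h := leq_trans (leq_coord_l1 x i) hx.
by rewrite inordK; move: (x i) h => z; lia.
Qed.

Lemma uniq_BP (d p : nat) : uniq (BP d p).
Proof.
apply: filter_uniq; rewrite map_inj_uniq ?enum_uniq // => f g /ffunP e.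
by apply/ffunP => i; apply/val_inj; have := e i; rewrite !ffunE /=; lia.
Qed.

Lemma mem_layer (d p : nat) (x : point d) : (x \in layer d p) = (l1 x == p) && in_Pdo x.
Proof. by rewrite mem_filter mem_BP; case: eqP => //= ->; rewrite leqnn. Qed.

Lemma uniq_layer (d p : nat) : uniq (layer d p).
Proof. exact/filter_uniq/uniq_BP. Qed.

Lemma sum_l1 (d : nat) (X : seq (point d)) : \sum_(x <- X) l1 x = \sum_(i < d) csum i X.
Proof. by rewrite exchange_big. Qed.

Lemma csum_kappa (d : nat) (X : seq (point d)) (i : 'I_d) : csum i X <= kappa X.
Proof. exact: (@leq_bigmax _ (fun i => csum i X)). Qed.

Lemma kappa_le (d k : nat) (X : seq (point d)) :
  (forall i, csum i X <= k) -> kappa X <= k.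
Proof. by move=> h; apply/bigmax_leqP => i _; apply: h. Qed.

Lemma csum_cat (d : nat) (i : 'I_d) (X Y : seq (point d)) :
  csum i (X ++ Y) = csum i X + csum i Y.
Proof. exact: big_cat. Qed.

Lemma csum_perm (d : nat) (i : 'I_d) (X Y : seq (point d)) :
  perm_eq X Y -> csum i X = csum i Y.
Proof. exact: perm_big. Qed.

Lemma leq_sum_subset (T : eqType) (s s' : seq T) (F : T -> nat) :
  uniq s -> uniq s' -> {subset s <= s'} ->
  \sum_(x <- s) F x <= \sum_(x <- s') F x.
Proof.
move=> us us' ss; apply: (uniq_sub_le_big (op := addn) (le := leq)) => //.
by move=> x y /=; apply: leq_addr.
Qed.

(** * The cyclic shift on primitive points up to sign *)

Lemma exists_argmin (d : nat) (P : pred 'I_d) (i : 'I_d) : P i ->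
  exists2 j, P j & forall k : 'I_d, k < j -> ~~ P k.
Proof.
move=> Pi; case: (arg_minnP (fun i : 'I_d => i : nat) Pi) => j Pj hj.
by exists j => // k; apply: contraL => /hj; rewrite leqNgt.
Qed.

Definition opp (d : nat) (x : point d) : point d := [ffun i => (- x i)%R].

Lemma first_nonzero_posP (d : nat) (x : point d) :
  reflect (exists2 i, (0 < x i)%R & forall j : 'I_d, j < i -> x j = 0%R)
          (first_nonzero_pos x).
Proof.
apply: (iffP existsP) => [[i /andP[h /forallP hi]]|[i h hi]]; exists i => //.
  by move=> j lt; have := hi j; rewrite lt => /eqP.
by rewrite h; apply/forallP => j; apply/implyP => /hi ->.
Qed.

(** The hypothesis only says that [x] is nonzero; its first nonzero coordinate decides the sign of
    [x] and of [opp x] alike. *)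
Lemma first_nonzero_pos_opp (d : nat) (x : point d) (i : 'I_d) : x i != 0%R ->
  first_nonzero_pos (opp x) = ~~ first_nonzero_pos x.
Proof.
move=> /(@exists_argmin _ (fun i => x i != 0%R)) [j xj hj].
have h0 (k : 'I_d) : k < j -> x k = 0%R by move=> /hj; rewrite negbK => /eqP.
have fj (y : point d) : y j != 0%R -> (forall k : 'I_d, k < j -> y k = 0%R) ->
    first_nonzero_pos y = (0 < y j)%R.
  move=> yj y0; apply/first_nonzero_posP/idP => [[l yl hl]|yp]; last by exists j.
  case: (ltngtP l j) => lj; first by move: yl; rewrite y0.
    by move: yj; rewrite hl ?eqxx.
  by have <- : l = j by apply/val_inj.
rewrite !fj //; first by rewrite ffunE; lia.
  by rewrite ffunE oppr_eq0.
by move=> k /h0 e; rewrite ffunE e oppr0.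
Qed.

Lemma first_nonzero_pos_ge0 (d : nat) (x : point d) (i : 'I_d) :
  x i != 0%R -> (forall j, (0 <= x j)%R) -> first_nonzero_pos x.
Proof.
move=> /(@exists_argmin _ (fun i => x i != 0%R)) [j xj hj] x0.
apply/first_nonzero_posP; exists j; first by have := x0 j; lia.
by move=> k /hj; rewrite negbK => /eqP.
Qed.

Lemma primitive_neq0 (d : nat) (x : point d) : primitive x -> exists i, x i != 0%R.
Proof.
move=> px; apply/existsP; apply: contraLR px => /existsPn h.
rewrite /primitive big1 // => i _.
by have := h i; rewrite negbK => /eqP ->.
Qed.

Lemma primitive_coprime (d : nat) (x : point d) (i j : 'I_d) :
  coprime `|x i|%N `|x j|%N -> primitive x.
Proof.
move=> cij; rewrite /primitive -dvdn1 -(eqP cij) dvdn_gcd.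
by rewrite (biggcdn_inf i) ?(biggcdn_inf j).
Qed.

Lemma primitive_abs (d : nat) (x y : point d) (s : 'I_d -> 'I_d) : bijective s ->
  (forall i, `|y i|%N = `|x (s i)|%N) -> primitive y = primitive x.
Proof.
move=> sb e; rewrite /primitive (eq_bigr _ (fun i _ => e i)).
by rewrite [in RHS](reindex_inj (bij_inj sb)).
Qed.

Lemma l1_abs (d : nat) (x y : point d) (s : 'I_d -> 'I_d) : bijective s ->
  (forall i, `|y i|%N = `|x (s i)|%N) -> l1 y = l1 x.
Proof.
move=> sb e; rewrite /l1 (eq_bigr _ (fun i _ => e i)).
by rewrite [in RHS](reindex_inj (bij_inj sb)).
Qed.

(* The cyclic shift of coordinates, acting on primitive points up to sign. *)
Definition cyc (d : nat) (x : point d) : point d :=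
  let y := [ffun i => x (ordS i)] in if first_nonzero_pos y then y else opp y.

Lemma abs_cyc (d : nat) (x : point d) (i : 'I_d) : `|cyc x i|%N = `|x (ordS i)|%N.
Proof. by rewrite /cyc; case: ifP => _; rewrite !ffunE ?abszN. Qed.

Lemma l1_cyc (d : nat) (x : point d) : l1 (cyc x) = l1 x.
Proof. exact: l1_abs (ordS_bij d) (abs_cyc x). Qed.

Lemma cyc_in_Pdo (d : nat) (x : point d) : in_Pdo x -> in_Pdo (cyc x).
Proof.
move=> /andP[px _]; rewrite /in_Pdo (primitive_abs (ordS_bij d) (abs_cyc x)) px /=.
have [i xi] := primitive_neq0 px.
rewrite /cyc; case: ifP => // /negbT.
rewrite -(@first_nonzero_pos_opp _ _ (ord_pred i)) //.
by rewrite ffunE ord_predK.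
Qed.

Lemma cyc_ge0 (d : nat) (x : point d) : in_Pdo x -> (forall i, (0 <= x i)%R) ->
  cyc x = [ffun i => x (ordS i)].
Proof.
move=> /andP[/primitive_neq0[i xi] _] x0; rewrite /cyc.
rewrite (@first_nonzero_pos_ge0 _ _ (ord_pred i)) ?ffunE ?ord_predK // => j.
by rewrite ffunE.
Qed.

Lemma in_Pdo_opp (d : nat) (x : point d) : in_Pdo x -> in_Pdo (opp x) = false.
Proof.
move=> /andP[/primitive_neq0[i xi] fx]; rewrite /in_Pdo.
by rewrite (first_nonzero_pos_opp xi) fx andbF.
Qed.

Lemma iter_cyc_sign (d n : nat) (x : point d) :
  iter n (@cyc d) x = [ffun i => x (iter n (@ordS d) i)] \/
  iter n (@cyc d) x = opp [ffun i => x (iter n (@ordS d) i)].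
Proof.
elim: n => [|n IH]; first by left; apply/ffunP => i; rewrite ffunE.
rewrite iterS; set y := iter n _ x in IH *.
have cE z : cyc z = [ffun i => z (ordS i)] \/ cyc z = opp [ffun i => z (ordS i)].
  by rewrite /cyc; case: ifP => _; [left|right].
case: (cE _ y) => ->; case: IH => ->; [left|right|right|left];
  by apply/ffunP => i; rewrite !ffunE ?opprK -iterSr.
Qed.

Lemma iter_ordS (d : nat) (i : 'I_d) (n : nat) : val (iter n (@ordS d) i) = (i + n) %% d.
Proof.
elim: n => [|n IH]; first by rewrite addn0 modn_small.
by rewrite iterS /= IH -addn1 modnDml addn1 addnS.
Qed.

Lemma iter_in_Pdo (d n : nat) (x : point d) : in_Pdo x -> in_Pdo (iter n (@cyc d) x).
Proof. by move=> px; elim: n => //= n; apply: cyc_in_Pdo. Qed.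

(** After [d] shifts the coordinates are back in place, and the sign is right because [opp x] is not
    in P^d_o. *)
Lemma iter_cyc (d : nat) (x : point d) : in_Pdo x -> iter d (@cyc d) x = x.
Proof.
move=> px; have xE : [ffun i => x (iter d (@ordS d) i)] = x.
  apply/ffunP => i; rewrite ffunE; congr (x _); apply/val_inj.
  by rewrite iter_ordS modnDr modn_small.
have := iter_in_Pdo d px; case: (iter_cyc_sign d x) => ->; rewrite xE //.
by rewrite in_Pdo_opp.
Qed.

Lemma cyc_pred (d : nat) (x : point d) : in_Pdo x -> iter d.-1 (@cyc d) (cyc x) = x.
Proof.
move=> px; rewrite -iterSr prednK ?iter_cyc //.
by case/andP: px => /primitive_neq0[i _] _; apply: leq_ltn_trans (ltn_ord i).
Qed.

(** * Stable sets *)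

Definition stable (d : nat) (X : seq (point d)) : Prop :=
  [/\ uniq X, all (@in_Pdo d) X & {in X, forall x, cyc x \in X}].

Lemma stable_iter (d n : nat) (X : seq (point d)) (x : point d) :
  stable X -> x \in X -> iter n (@cyc d) x \in X.
Proof. by case=> _ _ hX xX; elim: n => //= n; apply: hX. Qed.

Lemma perm_cyc (d : nat) (X : seq (point d)) :
  stable X -> perm_eq [seq cyc x | x <- X] X.
Proof.
case=> uX /allP pX cX.
have uc : uniq [seq cyc x | x <- X].
  rewrite map_inj_in_uniq // => x y /pX px /pX py e.
  by rewrite -(cyc_pred px) e cyc_pred.
have sc : {subset [seq cyc x | x <- X] <= X} by move=> _ /mapP[x xX ->]; apply: cX.
apply: uniq_perm => //; apply: (uniq_min_size uc sc _).2.
by rewrite size_map.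
Qed.

Lemma csum_ordS (d : nat) (X : seq (point d)) (i : 'I_d) :
  stable X -> csum (ordS i) X = csum i X.
Proof.
move=> /perm_cyc /(csum_perm i) <-; rewrite /csum big_map.
by apply: eq_bigr => x _; rewrite abs_cyc.
Qed.

Lemma csum_stable (d : nat) (X : seq (point d)) (i j : 'I_d) :
  stable X -> csum i X = csum j X.
Proof.
move=> sX; have h n (k : 'I_d) : csum (iter n (@ordS d) k) X = csum k X.
  by elim: n => //= n IH; rewrite csum_ordS.
(* Going from [i] to [j] takes [j - i] shifts; adding [d] avoids a truncated subtraction. *)
rewrite -(h (j + (d - i)) i); congr csum; apply/val_inj; rewrite iter_ordS.
have li := ltn_ord i; have -> : i + (j + (d - i)) = j + d by lia.
by rewrite modnDr modn_small.
Qed.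

Lemma stable_l1 (d : nat) (X : seq (point d)) (i : 'I_d) :
  stable X -> \sum_(x <- X) l1 x = d * csum i X.
Proof.
move=> sX; rewrite sum_l1 (eq_bigr (fun=> csum i X)) => [|j _]; last exact: csum_stable.
by rewrite sum_nat_const card_ord.
Qed.

Lemma stable_kappa (d : nat) (X : seq (point d)) (i : 'I_d) :
  stable X -> csum i X = kappa X.
Proof.
move=> sX; apply/eqP; rewrite eqn_leq csum_kappa /=.
by apply: kappa_le => j; rewrite (csum_stable j i).
Qed.

Lemma stable_BP (d p : nat) : stable (BP d p).
Proof.
split; [exact: uniq_BP|by apply/allP => x; rewrite mem_BP => /andP[]|].
by move=> x; rewrite !mem_BP l1_cyc => /andP[-> /cyc_in_Pdo].
Qed.

Lemma stable_layer (d p : nat) : stable (layer d p).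
Proof.
split; [exact: uniq_layer|by apply/allP => x; rewrite mem_layer => /andP[]|].
by move=> x; rewrite !mem_layer l1_cyc => /andP[-> /cyc_in_Pdo].
Qed.

Definition sdiff (d : nat) (X U : seq (point d)) : seq (point d) :=
  [seq x <- X | x \notin U].

Lemma mem_sdiff (d : nat) (X U : seq (point d)) (x : point d) :
  (x \in sdiff X U) = (x \notin U) && (x \in X).
Proof. exact: mem_filter. Qed.

Lemma stableD (d : nat) (X U : seq (point d)) :
  stable X -> stable U -> stable (sdiff X U).
Proof.
move=> [uX pX cX] sU; split; first exact: filter_uniq.
  by apply/allP => x; rewrite mem_sdiff => /andP[_ /(allP pX)].
move=> x; rewrite !mem_sdiff => /andP[xU xX]; rewrite cX // andbT.
apply: contra xU => /(stable_iter d.-1 sU); rewrite cyc_pred //.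
exact: (allP pX).
Qed.

(** The last clause lets the orbit be removed whole from any stable set that it meets. *)
Lemma stable_orbit (d : nat) (x : point d) : in_Pdo x ->
  exists O, [/\ stable O, x \in O, size O <= d &
    forall X, stable X -> x \in X -> {subset O <= X}].
Proof.
move=> px; have d0 : 0 < d.
  by case/andP: px => /primitive_neq0[i _] _; apply: leq_ltn_trans (ltn_ord i).
exists (undup [seq iter j (@cyc d) x | j <- iota 0 d]); split.
- split; first exact: undup_uniq.
    by apply/allP => y; rewrite mem_undup => /mapP[j _ ->]; apply: iter_in_Pdo.
  move=> y; rewrite !mem_undup => /mapP[j]; rewrite mem_iota add0n => /= jd ->.
  rewrite -iterS; have [e|jd'] := eqVneq j.+1 d.
    by rewrite e iter_cyc //; apply/mapP; exists 0 => //; rewrite mem_iota.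
  by apply/mapP; exists j.+1 => //; rewrite mem_iota; lia.
- by rewrite mem_undup; apply/mapP; exists 0 => //; rewrite mem_iota.
- by apply: leq_trans (size_undup _) _; rewrite size_map size_iota.
- by move=> X sX xX y; rewrite mem_undup => /mapP[j _ ->]; apply: stable_iter.
Qed.

Lemma size_sdiff (d : nat) (X U : seq (point d)) : uniq X -> uniq U -> {subset U <= X} ->
  size X = size (sdiff X U) + size U.
Proof.
move=> uX uU sU; rewrite /sdiff -(count_predC (mem U) X) addnC -!size_filter; congr (_ + _).
apply/perm_size/uniq_perm => //; first exact: filter_uniq.
by move=> x; rewrite mem_filter; apply/andP/idP => [[]//|xU]; split=> //; apply: sU.
Qed.

(* Orbits of [cyc] have at most [d] elements, so removing them one at a time
   never jumps over a window of length [d]. *)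
Lemma stable_subset (d s : nat) (X : seq (point d)) : stable X -> s <= size X ->
  0 < d -> exists Z, [/\ stable Z, {subset Z <= X}, size Z <= s & s < size Z + d].
Proof.
move=> + + d0; have [n] := ubnP (size X); elim: n X => // n IH X ltn sX.
rewrite leq_eqVlt => /predU1P[->|lts].
  by exists X; split => //; rewrite -addn1 leq_add2l.
have [x xX] : exists x, x \in X by case: X lts {ltn sX} => // x X; exists x; rewrite mem_head.
have [uX pX cX] := sX.
have [O [sO xO szO /(_ X sX xX) OX]] := stable_orbit (allP pX _ xX).
have uO : uniq O by case: sO.
have e : size X = size (sdiff X O) + size O := size_sdiff uX uO OX.
have O0 : 0 < size O by case: O xO {sO szO OX uO e}.
set V := sdiff X O in e.
have sV : stable V by apply: stableD.
have VX : {subset V <= X} by move=> y; rewrite mem_sdiff => /andP[].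
have [sV'|sV'] := leqP s (size V); last by exists V; split => //; lia.
have [|Z [h1 h2 h3 h4]] := IH V _ sV sV'; first by lia.
by exists Z; split=> // z /h2 /VX.
Qed.

(** * Balanced subsets of a layer *)

(* [w] bounds the excess, in units of [1/d], over a perfectly balanced choice of
   [s] points of norm [p]. *)
Definition balanced_in (d : nat) (S : seq (point d)) (p w s : nat) : Prop :=
  exists Y, [/\ uniq Y, {subset Y <= S}, size Y = s &
                forall i, d * csum i Y <= s * p + w].

Lemma sum_l1_layer (d p : nat) (X : seq (point d)) :
  {subset X <= layer d p} -> \sum_(x <- X) l1 x = size X * p.
Proof.
move=> sX; rewrite (eq_big_seq (fun=> p)) => [|x /sX].
  by rewrite big_const_seq count_predT iter_addn_0 mulnC.
by rewrite mem_layer => /andP[/eqP].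
Qed.

(** A stable [Z] contributes exactly [size Z * p / d] to every coordinate, so all the excess comes
    from the points chosen in [U]. *)
Lemma balanced_in_add (d p w t : nat) (Z U S : seq (point d)) :
  stable Z -> {subset Z <= sdiff (layer d p) U} ->
  {subset U <= layer d p} -> balanced_in U p w t ->
  balanced_in (layer d p) p w (size Z + t).
Proof.
move=> sZ ZS US [W [uW WU szW hW]]; exists (Z ++ W).
have Zl : {subset Z <= layer d p} by move=> x /ZS; rewrite mem_sdiff => /andP[].
split=> [|x||i]; last 1 first.
- rewrite csum_cat mulnDr -(stable_l1 i sZ) (sum_l1_layer Zl) mulnDl -addnA leq_add2l.
  exact: hW.
- rewrite cat_uniq uW; case: sZ => -> _ _; rewrite andbT /=.
  apply/hasPn => x /WU xU; apply/negP => /ZS; rewrite mem_sdiff.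
  by rewrite /= xU.
- by rewrite mem_cat => /orP[/Zl//|/WU/US].
- by rewrite size_cat szW.
Qed.

(** The complement of [U] is stable, so it supplies all but [t] of the [s] points for some [t] with
    [a <= t < a + d]; [U] supplies the others. *)
Lemma balanced_in_window (d p w a s : nat) (U : seq (point d)) : 0 < d ->
  stable U -> {subset U <= layer d p} ->
  (forall t, a <= t < a + d -> balanced_in U p w t) ->
  a <= s -> s + size U <= size (layer d p) + a ->
  balanced_in (layer d p) p w s.
Proof.
move=> d0 sU US hU as_ sl.
have e : size (layer d p) = size (sdiff (layer d p) U) + size U :=
  size_sdiff (uniq_layer d p) (let: And3 h _ _ := sU in h) US.
have sV := stableD (stable_layer d p) sU.
have [|Z [sZ ZV z1 z2]] := @stable_subset _ (s - a) _ sV _ d0; first by lia.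
have -> : s = size Z + (s - size Z) by lia.
apply: (balanced_in_add (U := U)) => //; apply: hU; lia.
Qed.

(** When [s] is close to the size of the layer, the whole complement of [U] is used and [U] supplies
    the rest. The bound [d <= (size U).+1] makes every remainder below [d] available in [U]. *)
Lemma balanced_in_all (d p w s : nat) (U : seq (point d)) : 0 < d ->
  stable U -> {subset U <= layer d p} -> d <= (size U).+1 ->
  (forall t, t <= size U -> balanced_in U p w t) ->
  s <= size (layer d p) -> balanced_in (layer d p) p w s.
Proof.
move=> d0 sU US dU hU sl; have [h|h] := leqP (s + size U) (size (layer d p)).
  apply: (@balanced_in_window _ _ _ 0 _ U) => // [t /= td|]; last by rewrite addn0.
  by apply: hU; lia.
have e : size (layer d p) = size (sdiff (layer d p) U) + size U :=
  size_sdiff (uniq_layer d p) (let: And3 h _ _ := sU in h) US.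
have sV := stableD (stable_layer d p) sU; set V := sdiff _ _ in sV e.
have -> : s = size V + (s - size V) by lia.
apply: (balanced_in_add (U := U)) => //; apply: hU; lia.
Qed.

(** * Recurrences between balls *)

Lemma perm_BPS (d p : nat) : perm_eq (BP d p.+1) (BP d p ++ layer d p.+1).
Proof.
apply: uniq_perm; first exact: uniq_BP.
  rewrite cat_uniq uniq_BP uniq_layer andbT; apply/hasPn => x.
  by rewrite mem_layer /= mem_BP => /andP[/eqP -> _]; rewrite ltnn.
move=> x; rewrite mem_cat !mem_BP mem_layer; case: (in_Pdo x); rewrite ?andbT ?andbF //.
by rewrite leq_eqVlt orbC.
Qed.

Lemma N_S (d p : nat) : N_ d p.+1 = N_ d p + size (layer d p.+1).
Proof. by rewrite /N_ (perm_size (perm_BPS d p)) size_cat. Qed.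

Lemma N_0 (d : nat) : N_ d 0 = 0.
Proof.
apply/eqP; rewrite size_eq0; case e: (BP d 0) => [|x s] //.
have : x \in BP d 0 by rewrite e mem_head.
rewrite mem_BP => /andP[hx /andP[/primitive_neq0[i xi] _]].
have := leq_trans (leq_coord_l1 x i) hx; lia.
Qed.

Lemma sum_l1_BP (d p : nat) : 0 < d -> \sum_(x <- BP d p) l1 x = d * kappa_ d p.
Proof.
by move=> d0; rewrite (stable_l1 (Ordinal d0) (stable_BP d p)) stable_kappa //; apply: stable_BP.
Qed.

Lemma kappa_S (d p : nat) : 0 < d ->
  d * kappa_ d p.+1 = d * kappa_ d p + p.+1 * size (layer d p.+1).
Proof.
move=> d0; rewrite -!sum_l1_BP // (perm_big _ (perm_BPS d p)) big_cat /=.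
by rewrite (@sum_l1_layer d p.+1 (layer d p.+1)) // mulnC.
Qed.

Lemma kappa_0 (d : nat) : kappa_ d 0 = 0.
Proof.
have /eqP := N_0 d; rewrite size_eq0 /kappa_ => /eqP ->.
by rewrite /kappa big1 // => i _; rewrite big_nil.
Qed.

Lemma admissible_take (d k m : nat) (X : seq (point d)) :
  admissible d k X -> admissible d k (take m X).
Proof.
move=> [uX pX kX]; split; first exact: take_uniq.
  by apply/allP => x /mem_take /(allP pX).
apply: kappa_le => i; apply: leq_trans kX; apply: leq_trans (csum_kappa X i).
by have := csum_cat i (take m X) (drop m X); rewrite cat_take_drop => ->; apply: leq_addr.
Qed.

(** The ball is perfectly balanced, so only the layer matters. Coordinate sums are integers, whence
    the [.+1]: an excess [w < d] costs nothing when [s * p.+1 <= d * (k - kappa_ d p)]. *)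
Lemma admissible_layer (d k p w s : nat) : 0 < d -> kappa_ d p <= k ->
  balanced_in (layer d p.+1) p.+1 w s ->
  s * p.+1 + w < d * (k - kappa_ d p).+1 ->
  exists2 X, admissible d k X & size X = N_ d p + s.
Proof.
move=> d0 kp [Y [uY Yl szY hY]] hk; exists (BP d p ++ Y); last by rewrite size_cat szY.
split.
- rewrite cat_uniq uniq_BP uY andbT; apply/hasPn => x /Yl.
  by rewrite mem_layer /= mem_BP => /andP[/eqP -> _]; rewrite ltnn.
- rewrite all_cat; apply/andP; split; apply/allP => x; first by rewrite mem_BP => /andP[].
  by move=> /Yl; rewrite mem_layer => /andP[].
- apply: kappa_le => i; rewrite csum_cat (stable_kappa _ (stable_BP d p)) -/(kappa_ d p).
  have := leq_ltn_trans (hY i) hk; rewrite ltn_mul2l d0 /= ltnS; lia.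
Qed.

(** * Windows: layers whose norm is not divisible by the dimension *)

Definition npoint (d : nat) (f : 'I_d -> nat) : point d := [ffun i => Posz (f i)].

Lemma l1_npoint (d : nat) (f : 'I_d -> nat) : l1 (npoint f) = \sum_i f i.
Proof. by apply: eq_bigr => i _; rewrite ffunE. Qed.

Lemma npoint_inj (d : nat) (f g : 'I_d -> nat) : npoint f = npoint g -> f =1 g.
Proof. by move=> /ffunP e i; have := e i; rewrite !ffunE => -[]. Qed.

Lemma eq_npoint (d : nat) (f g : 'I_d -> nat) : f =1 g -> npoint f = npoint g.
Proof. by move=> e; apply/ffunP => i; rewrite !ffunE e. Qed.

Lemma npoint_in_Pdo (d : nat) (f : 'I_d -> nat) (i j : 'I_d) :
  coprime (f i) (f j) -> in_Pdo (npoint f).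
Proof.
move=> cij; have pf : primitive (npoint f).
  by apply: (primitive_coprime (i := i) (j := j)); rewrite !ffunE.
rewrite /in_Pdo pf; have [k fk] := primitive_neq0 pf.
by apply: first_nonzero_pos_ge0 fk _ => l; rewrite ffunE.
Qed.

Lemma cyc_npoint (d : nat) (f : 'I_d -> nat) : in_Pdo (npoint f) ->
  cyc (npoint f) = npoint (fun i => f (ordS i)).
Proof.
move=> pf; rewrite cyc_ge0 // => [|i]; last by rewrite ffunE.
by apply/ffunP => i; rewrite !ffunE.
Qed.

Lemma csum_npoint (I : Type) (d : nat) (F : I -> 'I_d -> nat) (L : seq I) (i : 'I_d) :
  csum i [seq npoint (F a) | a <- L] = \sum_(a <- L) F a i.
Proof. by rewrite /csum big_map; apply: eq_bigr => a _; rewrite ffunE. Qed.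

Lemma modn_ordS (d : nat) (a : 'I_d) : a.+1 %% d = if a.+1 == d then 0 else a.+1.
Proof.
by case: eqP => [->|/eqP ne]; rewrite ?modnn // modn_small // ltn_neqAle ne ltn_ord.
Qed.

(* The window of length [u] ending at [a] on the cycle 'I_d. *)
Definition window (d m u : nat) (a i : 'I_d) : nat := m + ((a + (d - i)) %% d < u).

Lemma window_ordS (d m u : nat) (a i : 'I_d) :
  window m u (ordS a) (ordS i) = window m u a i.
Proof.
have ha := ltn_ord a; have hi := ltn_ord i; rewrite /window /= !modn_ordS.
congr (m + (_ < u)); case: eqP => ea; case: eqP => ei.
- by rewrite subn0 add0n modnn (_ : a + (d - i) = d) ?modnn //; lia.
- by rewrite (_ : a + (d - i) = 0 + (d - i.+1) + d) ?modnDr //; lia.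
- by rewrite subn0 (_ : a + (d - i) = a.+1) ?modnDr //; lia.
- by congr (_ %% d); lia.
Qed.

Lemma sum_window (d u : nat) (a : 'I_d) : u <= d ->
  \sum_(i < d) ((a + (d - i)) %% d < u) = u.
Proof.
move=> ud; have d0 : 0 < d by apply: leq_ltn_trans (ltn_ord a).
(* The map sending [i] to [a - i] modulo [d] is an involution, so the sum counts the residues below
   [u]. *)
pose h (i : 'I_d) : 'I_d := Ordinal (ltn_pmod (a + (d - i)) d0).
have hK : involutive h.
  move=> i; apply/val_inj => /=; have ha := ltn_ord a; have hi := ltn_ord i.
  have [h1|h1] := leqP i a.
    rewrite (_ : a + (d - i) = (a - i) + d) ?modnDr; last by lia.
    rewrite (@modn_small (a - i)); last by lia.
    by rewrite (_ : a + _ = i + d) ?modnDr ?modn_small //; lia.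
  rewrite (@modn_small (a + (d - i))); last by lia.
  by rewrite (_ : a + _ = i) ?modn_small //; lia.
rewrite (reindex_inj (inv_inj hK)) -[RHS]muln1 -[X in X * _]card_ord -sum_nat_const.
rewrite [RHS](big_ord_widen d (fun=> 1) ud) [RHS]big_mkcond; apply: eq_bigr => i _.
by have := congr1 val (hK i) => /= ->; case: ltnP.
Qed.

Lemma window_in_layer (d p : nat) (a : 'I_d) : ~~ (d %| p) ->
  npoint (window (p %/ d) (p %% d) a) \in layer d p.
Proof.
move=> dp; have d0 : 0 < d by apply: leq_ltn_trans (ltn_ord a).
have u0 : 0 < p %% d by rewrite lt0n.
have ud : p %% d < d by rewrite ltn_mod.
rewrite mem_layer l1_npoint big_split /= sum_nat_const card_ord sum_window ?(ltnW ud) //.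
(* The window contains [a] but not [ordS a]: the two coordinates there are consecutive integers,
   hence coprime. *)
rewrite mulnC -divn_eq eqxx /=; apply: (@npoint_in_Pdo _ _ a (ordS a)).
have ha := ltn_ord a; rewrite /window /= modn_ordS; set u := p %% d in u0 ud *.
rewrite (_ : a + (d - a) = d) ?modnn ?u0; last by lia.
rewrite (_ : (_ %% d < u) = false) ?addn0 ?addn1 ?coprimeSn //.
case: eqP => e; first by rewrite subn0 modnDr modn_small; lia.
by rewrite modn_small; lia.
Qed.

(** The end [a] is the only index inside the window whose successor is outside. *)
Lemma window_inj (d m u : nat) (a b : 'I_d) : 0 < u < d ->
  window m u a =1 window m u b -> a = b.
Proof.
move=> /andP[u0 ud] e; have ha := ltn_ord a; have hb := ltn_ord b.
have d0 : 0 < d by lia.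
have hm (c x : nat) : c = x \/ c = x + d -> x < d -> c %% d = x.
  by case=> -> hx; rewrite ?modnDr modn_small.
have eq_lt c x c' x' : (c = x \/ c = x + d) -> x < d -> (c' = x' \/ c' = x' + d) ->
    x' < d -> (c %% d < u : nat) = (c' %% d < u) -> (x < u) = (x' < u).
  by move=> /hm h /h -> /hm h' /h' ->; case: (x < u); case: (x' < u).
have e0 := addnI (e a); have e1 := addnI (e (ordS a)).
apply/val_inj; case: (ltngtP a b) => // hab.
- have {}e0 : (0 < u) = (b - a < u) by apply: eq_lt e0; lia.
  have {}e1 : (d.-1 < u) = (b - a.+1 < u).
    by apply: eq_lt e1; rewrite /= ?modn_ordS ?ifN; lia.
  lia.
- have {}e0 : (0 < u) = (b + (d - a) < u) by apply: eq_lt e0; lia.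
  have {}e1 : (d.-1 < u) = (b + (d - a.+1) < u).
    by apply: eq_lt e1; rewrite /= ?modn_ordS; try case: ifP; lia.
  lia.
Qed.

(** Nonnegative points need no change of sign under [cyc], so stability only asks for an index map
    [s] that follows the shift. *)
Lemma stable_npoints (I : finType) (d : nat) (F : I -> 'I_d -> nat) (P : pred I)
    (s : I -> I) :
  {in P &, forall a b, F a =1 F b -> a = b} ->
  {in P, forall a, in_Pdo (npoint (F a))} ->
  {in P, forall a, s a \in P /\ F (s a) =1 F a \o @ordS d} ->
  stable [seq npoint (F a) | a <- enum P].
Proof.
move=> injF pF sF; split.
- rewrite map_inj_in_uniq ?enum_uniq // => a b; rewrite !mem_enum => aP bP.
  by move=> /npoint_inj /(injF _ _ aP bP).
- by apply/allP => x /mapP[a]; rewrite mem_enum => /pF h ->.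
move=> x /mapP[a]; rewrite mem_enum => aP ->.
rewrite cyc_npoint ?pF //; have [sP se] := sF a aP.
by apply/mapP; exists (s a); rewrite ?mem_enum //; apply: eq_npoint => i; rewrite se.
Qed.

Lemma divn_lower (a d : nat) : 0 < d -> a < d * (a %/ d) + d.
Proof. by move=> d0; rewrite {1}(divn_eq a d) mulnC ltn_add2l ltn_mod. Qed.

(* The [t] windows are taken at the jumps of [k |-> k t %/ d]: such evenly spread
   positions meet every window of length [u] about [t u / d] times. *)
Lemma balanced_in_windows (d m u t : nat) : 0 < u < d -> t <= d ->
  balanced_in [seq npoint (window m u a) | a : 'I_d] (d * m + u) d.-1 t.
Proof.
move=> /[dup] u0d /andP[u0 ud] td; have d0 : 0 < d by lia.
pose g k := k * t %/ d; have g_homo : {homo g : x y / x <= y}.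
  by move=> x y xy; rewrite leq_div2r // leq_mul2r xy orbT.
pose f k := g k.+1 - g k.
have gD k : g (k + d) = g k + t by rewrite /g mulnDl (mulnC d) divnDMl.
have fD k : f (k + d) = f k by rewrite /f -addSn !gD subnDr.
have f1 k : f k <= 1.
  rewrite /f leq_subLR /g -divnDMl // leq_div2r //.
  by rewrite mul1n mulSn addnC leq_add2l.
have fb k : (f k == 1) = f k :> nat by case: (f k) (f1 k) => [|[]].
pose A := [seq a : 'I_d <- enum 'I_d | f a == 1].
exists [seq npoint (window m u a) | a <- A]; split.
- rewrite map_inj_uniq => [|a b /npoint_inj]; first exact/filter_uniq/enum_uniq.
  exact: window_inj.
- move=> x /mapP[a _ ->]; apply/mapP; exists a => //; exact: mem_enum.
- rewrite size_map size_filter -sum1_count big_enum_cond /= big_mkcond /=.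
  rewrite (eq_bigr (fun i : 'I_d => f i)) => [|i _]; last by rewrite -[RHS]fb; case: eqP.
  by rewrite -(big_mkord xpredT f) telescope_sumn // /g mulKn // mul0n div0n subn0.
move=> i; rewrite csum_npoint /A big_filter big_enum_cond /= big_mkcond /=.
pose F (a : nat) := f a * (m + ((a + (d - i)) %% d < u)).
rewrite (eq_bigr (fun a : 'I_d => F a)); last first.
  by move=> a _; rewrite /F /window; have := fb a; case: eqP => _ <-; rewrite ?mul1n.
have hi := ltn_ord i.
(* Positions are counted from [i]: the window ending at [i + v] contains [i] exactly when
   [v < u]. *)
pose h (v : 'I_d) : 'I_d := Ordinal (ltn_pmod (i + v) d0).
have hh v : (h v + (d - i)) %% d = v.
  rewrite /= modnDml (_ : i + v + _ = v + d); last by lia.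
  by rewrite modnDr modn_small.
have h_inj : injective h.
  by move=> v w e; apply/val_inj => /=; rewrite -[LHS]hh -[RHS]hh e.
have fh v : f (h v) = f (i + v).
  have hv := ltn_ord v; rewrite /=; have [lt|ge] := ltnP (i + v) d; first by rewrite modn_small.
  have -> : i + v = (i + v - d) + d by lia.
  by rewrite modnDr fD modn_small //; lia.
rewrite (reindex_inj h_inj) /=.
have -> : \sum_(v < d) F (h v) = \sum_(v < d) f (i + v) * m + \sum_(v < u) f (i + v).
  rewrite [X in _ + X](big_ord_widen d (fun v => f (i + v)) (ltnW ud)).
  rewrite [X in _ + X]big_mkcond -big_split; apply: eq_bigr => v _ /=.
  rewrite /F hh fh mulnDr; congr (_ + _); by case: ltnP; rewrite ?muln1 ?muln0.
have fsum n : \sum_(v < n) f (i + v) = g (i + n) - g i.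
  rewrite -(big_mkord xpredT (fun v => f (i + v))) -telescope_sumn ?leq_addr //.
  by rewrite -{2}[i : nat]add0n big_addn addKn; apply: eq_bigr => v _; rewrite addnC.
rewrite -big_distrl /= !fsum gD addKn.
have gu := g_homo _ _ (leq_addr u i).
(* The number of jumps in [u] consecutive steps, [g (i + u) - g i], is at most
   [(u * t + d.-1) / d]. *)
have l1 : d * g (i + u) <= (i + u) * t by rewrite mulnC leq_divM.
have l2 := divn_lower (i * t) d0; rewrite -/(g i) in l2.
nia.
Qed.

Lemma balanced_in_ndvd (d p s : nat) : 0 < d -> ~~ (d %| p) -> s <= size (layer d p) ->
  balanced_in (layer d p) p d.-1 s.
Proof.
move=> d0 dp; have u0d : 0 < p %% d < d by rewrite lt0n dp ltn_mod.
apply: (balanced_in_all (U := [seq npoint (window (p %/ d) (p %% d) a) | a : 'I_d])) => //.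
- apply: (stable_npoints (s := @ord_pred d)) => [a b _ _|a _|a _].
  + exact: window_inj.
  + by have := window_in_layer a dp; rewrite mem_layer => /andP[].
  + by split=> // i /=; rewrite -{2}(ord_predK a) window_ordS.
- by move=> x /mapP[a _ ->]; apply: window_in_layer.
- by rewrite size_map -cardE card_ord.
- move=> t; rewrite size_map -cardE card_ord => td.
  by have := balanced_in_windows (p %/ d) u0d td; rewrite (mulnC d (p %/ d)) -divn_eq.
Qed.

(** * Transfers: layers whose norm is divisible by the dimension *)

Definition transfer (d m c : nat) (e : 'I_d * 'I_d) (i : 'I_d) : nat :=
  m + c * (i == e.1) - c * (i == e.2).

Lemma transferD (d m c : nat) (e : 'I_d * 'I_d) (i : 'I_d) : c <= m ->
  transfer m c e i + c * (i == e.2) = m + c * (i == e.1).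
Proof. by rewrite /transfer; case: (i == e.1); case: (i == e.2); lia. Qed.

Lemma l1_transfer (d m c : nat) (e : 'I_d * 'I_d) : c <= m ->
  l1 (npoint (transfer m c e)) = d * m.
Proof.
move=> cm; have sum_pt (a : 'I_d) : \sum_i c * (i == a) = c.
  by rewrite -big_distrr /= (bigD1 a) //= eqxx big1 ?muln1 // => i /negPf ->.
apply: (@addIn (\sum_i c * (i == e.2))).
rewrite l1_npoint -big_split /= (eq_bigr _ (fun i _ => transferD e i cm)) big_split /=.
by rewrite !sum_pt sum_nat_const card_ord.
Qed.

(** If every index occurs equally often as [e.1] and as [e.2], all coordinate sums equal
    [size L * m]. *)
Lemma csum_transfer (d m c : nat) (L : seq ('I_d * 'I_d)) (i : 'I_d) : c <= m ->
  csum i [seq npoint (transfer m c e) | e <- L] + c * count (fun e => i == e.2) L =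
  size L * m + c * count (fun e => i == e.1) L.
Proof.
move=> cm; have cnt (p : pred ('I_d * 'I_d)) : c * count p L = \sum_(e <- L) c * p e.
  rewrite -sum1_count big_mkcond big_distrr /=.
  by apply: eq_bigr => e _; case: (p e).
rewrite csum_npoint !cnt -big_split /= (eq_bigr _ (fun e _ => transferD e i cm)).
by rewrite big_split /= big_const_seq count_predT iter_addn_0 (mulnC m).
Qed.

Lemma transfer_inj (d m c : nat) (e e' : 'I_d * 'I_d) : 0 < c <= m ->
  e.1 != e.2 -> e'.1 != e'.2 -> transfer m c e =1 transfer m c e' -> e = e'.
Proof.
case: e e' => [a b] [a' b'] /= /andP[c0 cm] ab ab' E.
have /eqP -> : a == a'.
  have := E a; rewrite /transfer /= eqxx (negPf ab).
  by case: (a == a') => //; case: (a == b'); lia.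
have /eqP -> // : b == b'.
have := E b; rewrite /transfer /= eqxx eq_sym (negPf ab).
by case: (b == b') => //; case: (b == a'); lia.
Qed.

Lemma transfer_ordS (d m c : nat) (e : 'I_d * 'I_d) (i : 'I_d) :
  transfer m c e (ordS i) = transfer m c (ord_pred e.1, ord_pred e.2) i.
Proof.
have h a : (ordS i == a) = (i == ord_pred a).
  by rewrite -{1}(ord_predK a) (inj_eq (@ordS_inj d)).
by rewrite /transfer /= !h.
Qed.

(** Primitivity comes from two coprime coordinates: [m + 1] and an untouched [m] when [d > 2] and
    [c = 1], and otherwise [m + c] and [m - c]. *)
Lemma transfer_in_layer (d m c : nat) (e : 'I_d * 'I_d) : 
  c <= m -> e.1 != e.2 ->
  (2 < d) && (c == 1) || coprime (m + c) (m - c) ->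
  npoint (transfer m c e) \in layer d (d * m).
Proof.
move=> cm ne H; rewrite mem_layer l1_transfer // eqxx /=.
have t1 : transfer m c e e.1 = m + c by rewrite /transfer eqxx (negPf ne); lia.
have t2 : transfer m c e e.2 = m - c.
  by rewrite /transfer eqxx eq_sym (negPf ne); lia.
case/orP: H => [/andP[d3 /eqP c1]|H].
  have [k /norP[k1 k2]] : exists k : 'I_d, ~~ ((k == e.1) || (k == e.2)).
    apply/existsP; rewrite -negb_forall; apply: contraTN d3 => /forallP h.
    rewrite -leqNgt -(card_ord d) -[2]/(1 + 1) -{1}(card1 e.1) -(card1 e.2).
    rewrite -cardUI; apply: leq_trans (leq_addr _ _); apply: subset_leq_card.
    by apply/subsetP => k _; rewrite !inE.
  apply: (@npoint_in_Pdo _ _ e.1 k).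
  by rewrite t1 /transfer (negPf k1) (negPf k2) c1 addn1 muln0 addn0 subn0 coprimeSn.
by apply: (@npoint_in_Pdo _ _ e.1 e.2); rewrite t1 t2.
Qed.

Lemma leq_count1 (T I : eqType) (f : T -> I) (i : I) (L : seq T) :
  uniq (map f L) -> count (fun e => i == f e) L <= 1.
Proof.
move=> u; rewrite -(@eq_count _ (preim f (pred1 i))) => [|x]; last by rewrite /= eq_sym.
by rewrite -count_map count_uniq_mem // leq_b1.
Qed.

Lemma ordS_neq (d : nat) (a : 'I_d) : 1 < d -> a != ordS a.
Proof.
by move=> d1; apply/eqP => /(congr1 val) /=; rewrite modn_ordS; case: ifP => /eqP; lia.
Qed.

(* A path of transfers telescopes, so its excess is at most [c] per coordinate. *)
Lemma balanced_in_dvd (d m c s : nat) : 1 < d -> 0 < c <= m ->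
  (2 < d) && (c == 1) || coprime (m + c) (m - c) ->
  s <= size (layer d (d * m)) -> balanced_in (layer d (d * m)) (d * m) (d * c) s.
Proof.
move=> d1 /[dup] c0m /andP[c0 cm] H; have d0 : 0 < d by lia.
pose F (a : 'I_d) := transfer m c (a, ordS a).
have ne (a : 'I_d) : (a, ordS a).1 != (a, ordS a).2 by apply: ordS_neq.
have FI (a b : 'I_d) : F a =1 F b -> a = b.
  by move/(transfer_inj c0m (ne a) (ne b)) => -[].
apply: (balanced_in_all (U := [seq npoint (F a) | a : 'I_d])) => //.
- apply: (stable_npoints (s := @ord_pred d)) => [a b _ _|a _|a _].
  + exact: FI.
  + by have := transfer_in_layer cm (ne a) H; rewrite mem_layer => /andP[].
  + by split=> // i; rewrite /F /= transfer_ordS /= ordSK ord_predK.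
- by move=> x /mapP[a _ ->]; apply: transfer_in_layer (ne a) H.
- by rewrite size_map -cardE card_ord.
- move=> t; rewrite size_map -cardE card_ord => td.
  pose A := take t (enum 'I_d); have uA : uniq A by apply/take_uniq/enum_uniq.
  have szA : size A = t by rewrite size_takel // -cardE card_ord.
  exists [seq npoint (transfer m c e) | e <- [seq (a, ordS a) | a <- A]]; split.
  + rewrite -map_comp map_inj_uniq // => a b /npoint_inj.
    exact: FI.
  + move=> x; rewrite -map_comp => /mapP[a /mem_take aA ->].
    by apply/mapP; exists a.
  + by rewrite !size_map.
  + move=> i; have := csum_transfer [seq (a, ordS a) | a <- A] i cm.
    have /(leq_count1 i) : uniq [seq e.1 | e <- [seq (a, ordS a) | a <- A]].
      by rewrite -map_comp (eq_map (g := id)) // map_id.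
    rewrite size_map szA.
    move: (count _ _) (count _ _) (csum _ _) => x y z; nia.
Qed.

Lemma zip_rot_neq (T : eqType) (x y : T) (s : seq T) :
  uniq (x :: s) -> last x s != y -> all (fun e => e.1 != e.2) (zip (x :: s) (rcons s y)).
Proof.
elim: s x => [|z s IH] x; first by rewrite /= andbT.
rewrite cons_uniq => /andP[xs us] ls; rewrite /= -/(rcons _ _).
have := IH z us ls; rewrite /= => ->; rewrite andbT.
by apply: contra xs => /eqP ->; rewrite mem_head.
Qed.

Lemma closed_trail_cycle (T : eqType) (s : seq T) : uniq s -> 1 < size s ->
  let L := zip s (rot 1 s) in
  [/\ uniq L, all (fun e => e.1 != e.2) L, size L = size s &
      forall i, count (fun e => i == e.1) L = count (fun e => i == e.2) L].
Proof.
move=> us s1 L; have szr : size (rot 1 s) = size s by rewrite size_rot.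
have u1 : unzip1 L = s by rewrite unzip1_zip ?szr.
have u2 : unzip2 L = rot 1 s by rewrite unzip2_zip ?szr.
split; first by apply: (@map_uniq _ _ fst); rewrite -/(unzip1 _) u1.
- rewrite /L; case: s us s1 {szr u1 u2 L} => // x [|y s] // us _.
  rewrite rot1_cons; apply: zip_rot_neq => //.
  by move: us; rewrite /= => /andP[h _]; apply: contra h => /eqP <-; apply: mem_last.
- by rewrite size1_zip ?szr.
move=> i.
have h (f : T * T -> T) : count (fun e => i == f e) L = count_mem i (map f L).
  by rewrite count_map; apply: eq_count => e /=; rewrite eq_sym.
rewrite !h -/(unzip1 _) -/(unzip2 _) u1 u2.
by apply/permP; rewrite perm_sym perm_rot.
Qed.

(** Up to [t = size s], a cycle through [t] elements serves. For one more, take the cycle through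
    all elements but one, [z], and add the pairs from [z] to some [x] and back. These lengths fill a
    window of [size s] consecutive values, as [balanced_in_window] requires. *)
Lemma closed_trail (T : eqType) (s : seq T) (t : nat) : uniq s -> 2 < size s ->
  1 < t <= (size s).+1 ->
  exists L : seq (T * T), [/\ uniq L, all (fun e => e.1 != e.2) L, size L = t &
      forall i, count (fun e => i == e.1) L = count (fun e => i == e.2) L].
Proof.
move=> us s2 /andP[t1]; rewrite leq_eqVlt => /predU1P[->|ts].
  case: s us s2 => // z s; rewrite cons_uniq => /andP[zs us]; rewrite /= ltnS => s1.
  have [u n sz cnt] := closed_trail_cycle us s1; set L := zip _ _ in u n sz cnt.
  have [x xs] : exists x, x \in s.
    by case: s s1 {zs us L u n sz cnt} => // x s; exists x; rewrite mem_head.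
  have zx : z != x by apply: contraNneq zs => ->.
  have mL e : e \in L -> (e.1 \in s) && (e.2 \in s).
    case: e => a b /[dup] /(map_f fst) h1 /(map_f snd) h2.
    move: h1 h2; rewrite -/(unzip1 _) -/(unzip2 _) unzip1_zip ?unzip2_zip ?size_rot //.
    by rewrite mem_rot => -> ->.
  exists ((z, x) :: (x, z) :: L); split.
  - rewrite /= inE xpair_eqE negb_or (negPf zx) /= u andbT.
    by apply/andP; split; apply/negP => /mL /=; rewrite (negPf zs) ?andbF.
  - by rewrite /= zx eq_sym zx.
  - by rewrite /= sz.
  - by move=> i /=; rewrite cnt !addnA (addnC (i == z)).
have := @closed_trail_cycle _ (take t s) (take_uniq _ us).
rewrite size_takel // => /(_ t1) [*]; by exists (zip (take t s) (rot 1 (take t s))).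
Qed.

(** The stable family is that of all transfers with [c = 1], at most [d * d] in number. A closed
    trail has length at least 2, hence [1 < s]. *)
Lemma balanced_in_exact (d m s : nat) : 2 < d -> 0 < m -> 1 < s ->
  s + d * d <= size (layer d (d * m)) + 2 ->
  balanced_in (layer d (d * m)) (d * m) 0 s.
Proof.
move=> d2 m0 s1 sl; have d0 : 0 < d by lia.
pose P := [pred e : 'I_d * 'I_d | e.1 != e.2].
have UL : {subset [seq npoint (transfer m 1 e) | e <- enum P] <= layer d (d * m)}.
  move=> x /mapP[e]; rewrite mem_enum => eP ->.
  by apply: transfer_in_layer => //; rewrite d2.
apply: (balanced_in_window (a := 2) (U := [seq npoint (transfer m 1 e) | e <- enum P])) => //.
- apply: (stable_npoints (s := fun e => (ord_pred e.1, ord_pred e.2))) => [e e' eP eP'|e eP|e eP].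
  + exact: transfer_inj.
  + have := UL (npoint (transfer m 1 e)); rewrite mem_layer.
    by case/(_ _)/andP => //; apply/mapP; exists e; rewrite ?mem_enum.
  + split; last by move=> i; rewrite /= transfer_ordS.
    by rewrite inE /= (inj_eq (can_inj (@ord_predK d))).
- move=> t td.
  have [||L [uL nL szL cL]] := @closed_trail _ (enum 'I_d) t (enum_uniq _).
  + by rewrite -cardE card_ord.
  + by rewrite -cardE card_ord; lia.
  exists [seq npoint (transfer m 1 e) | e <- L]; split.
  + rewrite map_inj_in_uniq // => e e' /(allP nL) h /(allP nL) h' /npoint_inj.
    exact: transfer_inj.
  + move=> x /mapP[e /(allP nL) eP ->]; apply/mapP; exists e => //.
    by rewrite mem_enum.
  + by rewrite size_map.
  + move=> i; have := csum_transfer L i m0; rewrite cL szL => /addIn ->; lia.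
- apply: leq_trans sl; rewrite leq_add2l size_map -cardE.
  by apply: leq_trans (max_card _) _; rewrite card_prod !card_ord.
Qed.

(** Transfers fail here, since [1 + 1] and [1 - 1] are not coprime; the point (1, 1) is by itself
    stable and perfectly balanced. *)
Lemma balanced_in_dim2_norm2 (s : nat) : s <= size (layer 2 2) ->
  balanced_in (layer 2 2) 2 0 s.
Proof.
pose o : point 2 := npoint (fun=> 1).
have ol : o \in layer 2 2.
  by rewrite mem_layer l1_npoint sum_nat_const card_ord /= (@npoint_in_Pdo _ _ ord0 ord0).
have op : in_Pdo o by move: ol; rewrite mem_layer => /andP[].
apply: (balanced_in_all (U := [:: o])) => //.
- split=> //; first by rewrite /= op.
  move=> x; rewrite inE => /eqP ->; rewrite cyc_npoint // inE; apply/eqP.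
  exact: eq_npoint.
- by move=> x; rewrite inE => /eqP ->.
- move=> t /=; rewrite leq_eqVlt => /predU1P[->|].
    exists [:: o]; split => // i; rewrite /csum big_seq1 ffunE; lia.
  rewrite ltnS leqn0 => /eqP ->; exists [::]; split => // i.
  by rewrite /csum big_nil muln0.
Qed.

(** In dimension two and norm [2 * m], take [c = 1] for even [m] and [c = 2] for odd [m >= 3]: then
    [m - c] and [m + c] are odd and differ by 2 or 4. *)
Lemma balanced_in_layer (d p s : nat) : 1 < d -> 0 < p -> s <= size (layer d p) ->
  exists w, [/\ balanced_in (layer d p) p w s, w <= p + d.-1,
    d = 2 -> w <= 4, 2 < d -> w <= d & ~~ (d %| p) -> w <= d.-1].
Proof.
move=> d1 p0 sl; have d0 : 0 < d by lia.
have [dp|dp] := boolP (d %| p); last first.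
  by exists d.-1; split=> //; [apply: balanced_in_ndvd|lia..].
have [m pm] : exists m, p = d * m by case/dvdnP: dp => m ->; exists m; rewrite mulnC.
subst p; have m0 : 0 < m by move: p0; rewrite muln_gt0 => /andP[].
have [d2|d2] := ltnP 2 d.
  exists (d * 1); split; [|nia..]; apply: balanced_in_dvd; rewrite ?m0 ?d2 //.
have ed : d = 2 by lia.
subst d; have [om|em] := boolP (odd m); last first.
  exists (2 * 1); split; [|lia..]; apply: balanced_in_dvd; rewrite ?m0 //.
  apply/orP; right; case: m m0 em {p0 sl dp} => // m _ /negPn om.
  by rewrite addn1 subn1 /= -addn2 coprime_sym /coprime gcdnDl -/(coprime _ _) coprimen2.
have [m1|m1] := eqVneq m 1.
  by subst m; exists 0; split=> //; apply: balanced_in_dim2_norm2.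
have [k mk] : exists k, m = k + 2 by exists (m - 2); lia.
subst m; exists (2 * 2); split; [|lia..]; apply: balanced_in_dvd => //; first by lia.
apply/orP; right; rewrite addnK -addnA coprime_sym /coprime gcdnDl -/(coprime _ _).
by rewrite -[2 + 2]/(2 ^ 2) coprimeXr // coprimen2; move: om; rewrite oddD addbF.
Qed.

(** * Points with at most two nonzero coordinates *)

Definition pair_point (d a b : nat) (e : 'I_d * 'I_d) (i : 'I_d) : nat :=
  a * (i == e.1) + b * (i == e.2).

Lemma pair_point_in_layer (d a b : nat) (e : 'I_d * 'I_d) :
  e.1 != e.2 -> coprime a b -> npoint (pair_point a b e) \in layer d (a + b).
Proof.
move=> ne cab; rewrite mem_layer l1_npoint /pair_point big_split -!big_distrr /=.
have s1 (j : 'I_d) : \sum_i (i == j : nat) = 1.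
  by rewrite (bigD1 j) //= eqxx big1 // => i /negPf ->.
rewrite !s1 !muln1 eqxx; apply: (@npoint_in_Pdo _ _ e.1 e.2).
by rewrite !eqxx [e.2 == e.1]eq_sym (negPf ne) !muln0 !muln1 addn0.
Qed.

Lemma size_layer_gt0 (d p : nat) : 1 < d -> 0 < size (layer d p.+1).
Proof.
case: d => [|[|d]] // _; pose e : 'I_d.+2 * 'I_d.+2 := (ord0, ord_max).
have := @pair_point_in_layer _ 1 p e isT (coprime1n p).
by rewrite add1n; case: layer.
Qed.

Lemma size_layer_gt1 (d p : nat) : 1 < d -> 1 < p -> 1 < size (layer d p.+1).
Proof.
case: d => [|[|d]] // _ p1; pose e : 'I_d.+2 * 'I_d.+2 := (ord0, ord_max).
have h1 := @pair_point_in_layer _ 1 p e isT (coprime1n p).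
have h2 := @pair_point_in_layer _ p 1 e isT (coprimen1 p).
rewrite add1n addn1 in h1 h2.
set x := npoint _ in h1; set y := npoint _ in h2.
have xy : x != y.
  apply/eqP => /npoint_inj /(_ ord0); rewrite /pair_point /= !muln0 !muln1 !addn0; lia.
by apply: (@uniq_leq_size _ [:: x; y]) => [|z]; rewrite ?cons_uniq !inE ?xy // => /pred2P[->|->].
Qed.

(** * The interpolation and the two bounds *)

Lemma kappa_lt (d p : nat) : 1 < d -> kappa_ d p < kappa_ d p.+1.
Proof.
move=> d1; have := kappa_S p (ltnW d1); have := size_layer_gt0 p d1; nia.
Qed.

Lemma kappa_ltn (d : nat) : 1 < d -> {homo kappa_ d : p q / p < q}.
Proof. by move=> d1; apply: homo_ltn => [x y z|p]; [apply: ltn_trans|apply: kappa_lt]. Qed.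

Lemma kappa_leq (d p q : nat) : 1 < d -> p <= q -> kappa_ d p <= kappa_ d q.
Proof.
by move=> d1; rewrite leq_eqVlt => /predU1P[->//|/(kappa_ltn d1)/ltnW].
Qed.

Lemma N_leq (d p q : nat) : p <= q -> N_ d p <= N_ d q.
Proof.
move=> /subnK <-; elim: (q - p) => // n IH; rewrite addSn N_S.
exact: leq_trans (leq_addr _ _).
Qed.

Lemma leq_kappa (d p : nat) : 1 < d -> p <= kappa_ d p.
Proof. by move=> d1; elim: p => // p IH; apply: leq_ltn_trans IH (kappa_lt p d1). Qed.

Lemma p_succ (d k : nat) : exists q, p_ d k = q.+1.
Proof. by exists (p_ d k).-1. Qed.

Lemma kappa_p (d k : nat) : 1 < d -> kappa_ d (p_ d k).-1 <= k < kappa_ d (p_ d k).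
Proof.
move=> d1; rewrite /p_; set a := fun p => _; set s := iota _ _; rewrite -pred_Sn.
have ha : has a s.
  by apply/hasP; exists k.+1; [rewrite mem_iota; lia|apply: leq_kappa].
have hs : find a s < k.+1 by move: ha; rewrite has_find size_iota.
have ns i : i < k.+1 -> nth 0 s i = i.+1 by move=> hi; rewrite nth_iota // add1n.
have := nth_find 0 ha; rewrite ns // /a => ->; rewrite andbT.
case e : (find a s) => [|i]; first by rewrite kappa_0.
have := @before_find _ 0 a s i; rewrite e => /(_ (ltnSn i)).
rewrite ns /a => [h|]; last by apply: ltnW; rewrite -e.
by rewrite /= leqNgt h.
Qed.

Lemma p_unique (d k q : nat) : 1 < d -> kappa_ d q <= k < kappa_ d q.+1 -> p_ d k = q.+1.
Proof.
move=> d1 /andP[h1 h2]; have := kappa_p k d1.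
have [p ->] := p_succ d k => /= /andP[h3 h4]; congr _.+1.
by case: (ltngtP p q) => // /(kappa_leq d1); lia.
Qed.

(** The floor of [lambda d k] computed in [nat]; for [d > 1] the subtraction is exact by
    [kappa_p]. *)
Definition flambda (d k : nat) : nat :=
  N_ d (p_ d k).-1 + (d * (k - kappa_ d (p_ d k).-1)) %/ p_ d k.

Lemma floor_lambda (d k : nat) : 1 < d -> Num.floor (lambda d k) = Posz (flambda d k).
Proof.
move=> d1; have /andP[kq _] := kappa_p k d1; rewrite /lambda /flambda.
have [q e] := p_succ d k; rewrite e /= in kq *.
apply: floor_def; rewrite -natrB // -natrM; set a := d * _.
have q0 : (0 < q.+1%:R :> rat)%R by rewrite ltr0n.
rewrite -PoszD -!pmulrn -addnA !(natrD _ (N_ d q)) lerD2l ltrD2l.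
rewrite ler_pdivlMr // ltr_pdivrMr // -!natrM ler_nat ltr_nat leq_divM /=.
by rewrite addn1 ltn_ceil.
Qed.

Lemma balanced_in0 (d p w : nat) (S : seq (point d)) : balanced_in S p w 0.
Proof. by exists [::]; split => // i; rewrite /csum big_nil muln0. Qed.

(** A point outside the ball has norm at least [p.+1]; a point inside falls short of this by its
    deficit [p.+1 - l1 x]. *)
Lemma leq_sum_l1 (d p : nat) (X : seq (point d)) : all (@in_Pdo d) X ->
  p.+1 * size X <= \sum_(x <- X) l1 x +
                   \sum_(x <- X | x \in BP d p) (p.+1 - l1 x).
Proof.
move=> /allP pX; rewrite [X in _ + X]big_mkcond -big_split /=.
have -> : p.+1 * size X = \sum_(x <- X) p.+1.
  by rewrite big_const_seq count_predT iter_addn_0.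
rewrite big_seq [X in _ <= X]big_seq; apply: leq_sum => x xX.
by rewrite mem_BP pX // andbT; case: (leqP (l1 x) p); lia.
Qed.

Lemma sum_deficit (d p : nat) : 0 < d ->
  d * kappa_ d p + \sum_(x <- BP d p) (p.+1 - l1 x) = p.+1 * N_ d p.
Proof.
move=> d0; rewrite -sum_l1_BP // -big_split /= (eq_big_seq (fun=> p.+1)) => [|x].
  by rewrite big_const_seq count_predT iter_addn_0.
by rewrite mem_BP => /andP[h _]; lia.
Qed.

Lemma admissible_l1 (d k : nat) (X : seq (point d)) : admissible d k X ->
  \sum_(x <- X) l1 x <= d * k.
Proof.
case=> _ _ kX; rewrite sum_l1 -[d in d * k]card_ord -sum_nat_const.
by apply: leq_sum => i _; apply: leq_trans (csum_kappa X i) kX.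
Qed.

Lemma sum_deficit_subset (d p : nat) (X : seq (point d)) : uniq X ->
  \sum_(x <- X | x \in BP d p) (p.+1 - l1 x) <= \sum_(x <- BP d p) (p.+1 - l1 x).
Proof.
move=> uX; rewrite -big_filter; apply: leq_sum_subset => [||x].
- exact: filter_uniq.
- exact: uniq_BP.
- by rewrite mem_filter => /andP[].
Qed.

(** The total norm is at most [d * k] and the deficit at most that of the full ball, so [q.+1 * size
    X <= d * k + q.+1 * N_ d q - d * kappa_ d q]. *)
Lemma admissible_size (d k : nat) (X : seq (point d)) : 1 < d -> admissible d k X ->
  size X <= flambda d k.
Proof.
move=> d1 aX; have d0 := ltnW d1; have /andP[kq _] := kappa_p k d1.
rewrite /flambda; have [q e] := p_succ d k; rewrite e /= in kq *.
have := admissible_l1 aX; case: aX => uX pX _.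
have := leq_sum_l1 q pX; have := sum_deficit_subset q uX; have := sum_deficit q d0.
move: (\sum_(x <- X) l1 x) (\sum_(x <- X | _) _) (\sum_(x <- BP d q) _) => a b c.
move=> h1 h2 h3 h4; rewrite -leq_subLR leq_divRL // mulnBl mulnBr.
by rewrite (mulnC (size X)) (mulnC (N_ d q)); lia.
Qed.

Lemma flambdaE (d k : nat) : 1 < d -> exists q s,
  [/\ kappa_ d q <= k < kappa_ d q.+1, p_ d k = q.+1, flambda d k = N_ d q + s,
      s <= size (layer d q.+1) &
      s * q.+1 <= d * (k - kappa_ d q) < s.+1 * q.+1].
Proof.
move=> d1; have d0 := ltnW d1.
have := kappa_p k d1; rewrite /flambda; have [q ->] := p_succ d k.
move=> /= /[dup] h /andP[h1 h2].
exists q, ((d * (k - kappa_ d q)) %/ q.+1); split=> //.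
- rewrite -ltnS ltn_divLR // mulSn (mulnC (size _)) mulnBr; have := kappa_S q d0.
  have : d * k < d * kappa_ d q.+1 by rewrite ltn_pmul2l.
  by lia.
- by rewrite leq_divM ltn_ceil.
Qed.

Lemma size_ge_take (d k m : nat) (X : seq (point d)) : admissible d k X -> m <= size X ->
  exists2 Y, admissible d k Y & size Y = m.
Proof.
by move=> aX mX; exists (take m X); rewrite ?size_takel //; apply: admissible_take.
Qed.

Lemma flambda_gt0 (d k : nat) : 1 < d -> 0 < k -> 0 < flambda d k.
Proof.
move=> d1 k0; have [q [s [/andP[_ h] _ -> _ /andP[h1 h2]]]] := flambdaE k d1.
case: q h h1 h2 => [|q] h h1 h2; last first.
  by rewrite N_S; have := size_layer_gt0 q d1; lia.
rewrite N_0 add0n lt0n; apply: contraTneq h2 => ->; rewrite kappa_0; nia.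
Qed.

(** Dropping one point of the layer frees [q.+1], which pays for any excess up to [q.+1 + d.-1]. *)
Lemma admissible_pred (d k : nat) : 1 < d -> 0 < k ->
  exists2 X, admissible d k X & size X = (flambda d k).-1.
Proof.
move=> d1 k0; have d0 := ltnW d1; have [q [s [/andP[h _] _ -> sl /andP[h1 h2]]]] := flambdaE k d1.
have [X aX szX] : exists2 X, admissible d k X & size X = N_ d q + s.-1.
  have [|w [bal hw _ _ _]] := @balanced_in_layer d q.+1 s.-1 d1 isT; first by lia.
  case: s sl h1 h2 bal => [|s] sl h1 h2 bal /=.
    by apply: (admissible_layer d0 h (balanced_in0 q.+1 0 _)); rewrite add0n muln_gt0 d0.
  by apply: (admissible_layer d0 h bal); move: h1; rewrite mulSn mulnS /=; lia.
by apply: (size_ge_take aX); rewrite szX; case: s {sl h1 h2 szX} => [|s]; lia.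
Qed.

(** * Where the upper bound may fail to be attained *)

Lemma not_attained_dim2 (k : nat) :
  ~ (exists2 X, admissible 2 k X & size X = flambda 2 k) ->
  exists q s, [/\ kappa_ 2 q <= k, p_ 2 k = q.+1, flambda 2 k = N_ 2 q + s, 0 < s &
                  2 * (k - kappa_ 2 q) <= s * q.+1 + 2].
Proof.
have [q [s [/andP[h _] hp -> sl /andP[h1 h2]]]] := @flambdaE 2 k isT => nX.
exists q, s; split => //.
  rewrite lt0n; apply/eqP => s0; apply: nX; rewrite s0.
  by apply: (admissible_layer _ h (balanced_in0 q.+1 0 _)).
have [w [bal _ /(_ erefl) hw _ _]] := @balanced_in_layer 2 q.+1 s isT isT sl.
(* Above [s * q.+1 + 2] there would be room for an excess of 4. *)
rewrite leqNgt; apply/negP => hlt; apply: nX.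
by apply: (admissible_layer _ h bal) => //; lia.
Qed.

(** Since [w <= d], failure leaves no slack at all, in a layer whose norm [d] divides. Exact balance
    must then be out of reach, so [s] is 1 or close to the size of the layer. *)
Lemma not_attained (d k : nat) : 2 < d ->
  ~ (exists2 X, admissible d k X & size X = flambda d k) ->
  exists q s, [/\ p_ d k = q.+1, k = kappa_ d q + s * (q.+1 %/ d),
                  s <= size (layer d q.+1) &
                  s = 1 \/ size (layer d q.+1) < s + d * d].
Proof.
move=> d2; have d1 := ltnW d2; have d0 := ltnW d1.
have [q [s [/andP[h _] hp -> sl /andP[h1 h2]]]] := flambdaE k d1 => nX.
exists q, s; have [w [bal _ _ /(_ d2) hw hw']] := balanced_in_layer d1 (isT : 0 < q.+1) sl.
have hlt : ~ (s * q.+1 + w < d * (k - kappa_ d q).+1).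
  by move=> /(admissible_layer d0 h bal).
have dq : d %| q.+1.
  apply/negPn/negP => /hw' {}hw; apply: hlt; rewrite mulnS; lia.
have e : d * (k - kappa_ d q) = s * q.+1 by rewrite mulnS in hlt; lia.
have ek : k - kappa_ d q = s * (q.+1 %/ d).
  by apply/eqP; rewrite -(eqn_pmul2l d0) e mulnCA [d * _]mulnC divnK.
split=> //; first by rewrite -ek; lia.
have [s1|s1] := eqVneq s 1; [by left|right].
rewrite ltnNge; apply/negP => sl'; apply: nX.
have [s0|s0] := eqVneq s 0.
  rewrite s0; apply: (admissible_layer d0 h (balanced_in0 q.+1 0 _)).
  by rewrite muln_gt0 d0.
have [m em] : exists m, q.+1 = d * m by case/dvdnP: dq => m ->; exists m; rewrite mulnC.
have m0 : 0 < m by move: (isT : 0 < q.+1); rewrite em muln_gt0 => /andP[].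
have : balanced_in (layer d (d * m)) (d * m) 0 s.
  by apply: balanced_in_exact => //; rewrite -?em; lia.
rewrite -em => {}bal; apply: (admissible_layer d0 h bal).
by rewrite mulnS; lia.
Qed.

(** * Infinitely many exceptions *)

(** The layer has at least two points, so [j], the share of a single point in each coordinate, is
    less than [kappa_ d q.+1 - kappa_ d q]. *)
Lemma layer_gap (d j q : nat) : 1 < d -> 1 < j -> d * j = q.+1 ->
  p_ d (kappa_ d q + j) = q.+1 /\ flambda d (kappa_ d q + j) = (N_ d q).+1.
Proof.
move=> d1 j1 e; have d0 := ltnW d1.
have hp : p_ d (kappa_ d q + j) = q.+1.
  apply: p_unique => //; rewrite leq_addr /= -(ltn_pmul2l d0) kappa_S // mulnDr e.
  by have := @size_layer_gt1 d q d1 _; nia.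
by split=> //; rewrite /flambda hp /= addKn e divnn addn1.
Qed.

(* A set of that size would have to be [BP d q] plus one point of norm [d j] all of
   whose coordinates are [j] in absolute value, which is not primitive. *)
Lemma layer_gap_not_attained (d j q : nat) : 1 < d -> 1 < j -> d * j = q.+1 ->
  ~ (exists2 X, admissible d (kappa_ d q + j) X & size X = (N_ d q).+1).
Proof.
move=> d1 j1 e [X aX szX]; have d0 := ltnW d1.
have hl1 := admissible_l1 aX; have [uX pX kX] := aX.
have h1 := leq_sum_l1 q pX; have h2 := sum_deficit q d0.
(* So many points use up the whole norm budget: the deficit must be that of the full ball, and no
   point of the ball is missing. *)
have BX : {subset BP d q <= X}.
  move=> z zB; apply/negPn/negP => zX.
  have h3 : \sum_(x <- X | x \in BP d q) (q.+1 - l1 x) <=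
            \sum_(x <- rem z (BP d q)) (q.+1 - l1 x).
    rewrite -big_filter; apply: leq_sum_subset => [||x].
    - exact: filter_uniq.
    - exact/rem_uniq/uniq_BP.
    - rewrite mem_filter mem_rem_uniq ?uniq_BP // => /andP[xB xX].
      by rewrite !inE xB andbT; apply: contraNneq zX => <-.
  have lz : l1 z <= q by move: zB; rewrite mem_BP => /andP[].
  move: h2; rewrite (big_rem z zB) /=; move: h3 h1 hl1; rewrite szX mulnDr e mulnS.
  move: (\sum_(x <- X) _) (\sum_(x <- X | _) _) (\sum_(x <- rem _ _) _) => a b c.
  by move: (d * _) (q.+1 * _) => u v; lia.
have szD := size_sdiff uX (uniq_BP d q) BX.
have [y yD] : exists y, y \in sdiff X (BP d q).
  move: szD; rewrite szX -/(N_ d q); case: (sdiff _ _) => [|y D _]; first by rewrite /=; lia.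
  by exists y; rewrite mem_head.
move: yD; rewrite mem_sdiff => /andP[yB yX].
have py : in_Pdo y by apply: (allP pX).
(* The ball already takes [kappa_ d q] in every coordinate, which leaves [j] for [y]. *)
have yj i : `|y i|%N <= j.
  rewrite -(leq_add2l (kappa_ d q)); apply: leq_trans kX; apply: leq_trans (csum_kappa X i).
  rewrite -[kappa_ d q](stable_kappa i (stable_BP d q)) addnC.
  have -> : `|y i|%N + csum i (BP d q) = csum i (y :: BP d q) by rewrite /csum big_cons.
  apply: leq_sum_subset => [|//|x]; first by rewrite /= yB uniq_BP.
  by rewrite inE => /predU1P[->|/BX].
have ly : d * j <= l1 y by move: yB; rewrite mem_BP py andbT -ltnNge e.
have yE i : `|y i|%N = j.
  apply/eqP; rewrite eqn_leq yj leqNgt /=; apply/negP => lt; move: ly.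
  rewrite leqNgt => /negP; apply; have -> : d * j = \sum_(i < d) j.
    by rewrite sum_nat_const card_ord.
  rewrite /l1 (bigD1 i) //= [X in _ < X](bigD1 i) //= -addSn leq_add //.
  by apply: leq_sum => k _; apply: yj.
have /andP[/eqP gy _] := py.
have : j %| 1 by rewrite -gy; apply/dvdn_biggcdP => i _; rewrite yE.
by rewrite dvdn1; lia.
Qed.

(** * Sparsity of the exceptions *)

Lemma leq_p (d k k' : nat) : 1 < d -> k <= k' -> p_ d k <= p_ d k'.
Proof.
move=> d1 kk; have := kappa_p k d1; have := kappa_p k' d1.
have [q ->] := p_succ d k; have [q' ->] := p_succ d k' => /= /andP[_ h1] /andP[h2 _].
rewrite ltnNge; apply/negP => h3; have := kappa_leq d1 h3; lia.
Qed.

Lemma flambda_leq_N (d k q : nat) : 1 < d -> k < kappa_ d q -> flambda d k <= N_ d q.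
Proof.
move=> d1 kq; have [q' [s [/andP[h1 _] _ -> sl _]]] := flambdaE k d1.
rewrite (@leq_trans (N_ d q'.+1)) ?N_S ?leq_add2l // -N_S; apply: N_leq.
by rewrite ltnNge; apply/negP => /(kappa_leq d1); lia.
Qed.

Lemma leq_flambda (d k k' : nat) : 1 < d -> k <= k' -> flambda d k <= flambda d k'.
Proof.
move=> d1 kk; have [q [s [/andP[h1 h2] hp -> _ /andP[h3 h4]]]] := flambdaE k' d1.
have [lt|ge] := ltnP k (kappa_ d q).
  by apply: leq_trans (flambda_leq_N d1 lt) (leq_addr _ _).
rewrite /flambda (@p_unique d k q) // ?ge ?(leq_ltn_trans kk) //= leq_add2l.
rewrite -ltnS ltn_divLR //; apply: leq_ltn_trans h4.
by rewrite leq_mul2l leq_sub2r // orbT.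
Qed.

(** Beyond [kappa_ d Q] every slope [d / p] of the interpolation is at most [d / Q]. *)
Lemma flambda_sublinear (d k Q : nat) : 1 < d -> kappa_ d Q <= k ->
  Q * flambda d k <= Q * N_ d Q + d * k.
Proof.
move=> d1 Qk; have d0 := ltnW d1.
have [q [s [/andP[h1 h2] _ -> _ /andP[h3 _]]]] := flambdaE k d1.
have Qq : Q <= q by rewrite -ltnS ltnNge; apply/negP => /(kappa_leq d1); lia.
have hN : Q * N_ d q <= Q * N_ d Q + d * kappa_ d q.
  rewrite -(subnKC Qq); elim: (q - Q) => [|n IH]; first by rewrite addn0 leq_addr.
  rewrite addnS N_S kappa_S // mulnDr addnA leq_add // leq_mul2r.
  by apply/orP; right; lia.
have hs : Q * s <= d * (k - kappa_ d q).
  by apply: leq_trans h3; rewrite mulnC leq_mul2l; apply/orP; right; lia.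
by rewrite mulnDr (leq_trans (leq_add hN hs)) // -addnA -mulnDr subnKC.
Qed.

(** With [h = p %/ d], take the points with first coordinate 1, second in [[h, 2h)] and the others
    in [[0, h)]: there are [h ^ (d - 1)] of them, of norm at most [d * h], and each adds at least
    [h] to the second coordinate sum. *)
Lemma kappa_lower (d p : nat) : 1 < d -> (p %/ d) ^ d <= kappa_ d p.
Proof.
case: d => // d; rewrite ltnS => d0; set h := p %/ d.+1.
pose j0 : 'I_d := Ordinal d0.
pose f (b : {ffun 'I_d -> 'I_h}) (i : 'I_d.+1) : nat :=
  if unlift ord0 i is Some j then (j == j0) * h + b j else 1.
have f0 b : f b ord0 = 1 by rewrite /f unlift_none.
have fS b j : f b (lift ord0 j) = (j == j0) * h + b j by rewrite /f liftK.
pose X := [seq npoint (f b) | b : {ffun 'I_d -> 'I_h}].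
have XB : {subset X <= BP d.+1 p}.
  move=> x /mapP[b _ ->]; rewrite mem_BP (@npoint_in_Pdo _ _ ord0 ord0) ?f0 // andbT.
  rewrite l1_npoint big_ord_recl f0 (eq_bigr _ (fun j _ => fS b j)) big_split /=.
  have -> : \sum_(j < d) (j == j0) * h = h.
    by rewrite (bigD1 j0) // eqxx mul1n big1 => [|j /negPf ->] //; apply: addn0.
  have hb : \sum_(j < d) (b j : nat) <= d * h.-1.
    rewrite -[d in d * _]card_ord -sum_nat_const; apply: leq_sum => j _.
    by have := ltn_ord (b j); lia.
  have h0 : 0 < h by apply: leq_ltn_trans (ltn_ord (b j0)).
  have : d.+1 * h <= p by rewrite mulnC leq_divM.
  have e : d * h = d * h.-1 + d by rewrite -mulnSr prednK.
  by move: (\sum_(j < d) (b j : nat)) hb => sb; rewrite mulSn e; lia.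
have uX : uniq X.
  rewrite map_inj_uniq ?enum_uniq // => b b' /npoint_inj e.
  by apply/ffunP => j; apply/val_inj; have := e (lift ord0 j); rewrite !fS => /addnI.
have szX : size X = h ^ d by rewrite size_map -cardE card_ffun !card_ord.
apply: leq_trans (csum_kappa _ (lift ord0 j0)).
apply: leq_trans (leq_sum_subset _ uX (uniq_BP _ _) XB).
have -> : h ^ d.+1 = \sum_(x <- X) h.
  by rewrite big_const_seq count_predT iter_addn_0 szX expnS.
rewrite [leqLHS]big_seq [leqRHS]big_seq; apply: leq_sum => x /mapP[b _ ->].
by rewrite ffunE /= fS eqxx mul1n leq_addr.
Qed.

Definition attained (d k : nat) : Prop :=
  exists2 X, admissible d k X & size X = flambda d k.

Lemma countE_S (E : pred nat) (k : nat) : countE E k.+1 = countE E k + E k.+1.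
Proof. have e := iotaD 1 k 1; rewrite addn1 in e.
by rewrite /countE e count_cat /= addn0. Qed.

(** For [d > 2], the candidates left by [not_attained] in the first [P] layers, possibly with
    repetitions. *)
Definition exceptions (d P : nat) : seq nat :=
  flatten [seq [seq kappa_ d q + s * (q.+1 %/ d) |
                s <- 1 :: [seq size (layer d q.+1) - j | j <- iota 0 (d * d)]]
          | q <- iota 0 P].

Lemma size_exceptions (d P : nat) : size (exceptions d P) = P * (d * d).+1.
Proof.
rewrite size_flatten /shape -map_comp sumnE big_map.
rewrite (eq_bigr (fun=> (d * d).+1)) => [|q _]; last first.
  by rewrite /= !size_map size_iota.
by rewrite big_const_seq count_predT iter_addn_0 size_iota mulnC.
Qed.

Lemma countE_exceptions (d K : nat) (E : pred nat) : 2 < d ->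
  (forall k, E k -> ~ attained d k) -> countE E K <= p_ d K * (d * d).+1.
Proof.
move=> d2 hE; rewrite /countE -size_filter -size_exceptions.
apply: uniq_leq_size => [|k]; first exact/filter_uniq/iota_uniq.
rewrite mem_filter mem_iota => /andP[/hE /(not_attained d2) [q [s [hp ek sl hs]]] hk].
have hpK : p_ d k <= p_ d K by apply: leq_p; [exact: ltnW|lia].
rewrite ek; apply/flattenP; eexists.
  by apply/mapP; exists q; [rewrite mem_iota; lia|reflexivity].
apply/mapP; exists s => //; rewrite inE; case: hs => [->|hs]; first by rewrite eqxx.
apply/orP; right; apply/mapP; exists (size (layer d q.+1) - s); last by lia.
by rewrite mem_iota; lia.
Qed.

(** The conclusion is the integer form of [countE E k <= k^(1/(d-1)) / M]. The count is at most
    linear in [h = q %/ d], while [k >= h ^ d]; the spare factor [h] absorbs the constant. *)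
Lemma sparse_nat_gt2 (d : nat) (E : pred nat) : 2 < d ->
  (forall k, E k -> ~ attained d k) ->
  forall M, exists K, forall k, K <= k -> (M * countE E k) ^ (d - 1) <= k.
Proof.
move=> d2 hE M; have d1 := ltnW d2; pose C := M * (d * d).+1 * (2 * d).
(* This threshold makes [h] exceed [C ^ (d - 1)]. *)
exists (kappa_ d (d * (C ^ (d - 1)).+1)) => k hk.
have cE := countE_exceptions k d2 hE; have := kappa_p k d1.
have [q e] := p_succ d k; rewrite e /= in cE * => /andP[h1 h2].
have hq : d * (C ^ (d - 1)).+1 <= q.
  by rewrite -ltnS ltnNge; apply/negP => /(kappa_leq d1); lia.
set h := q %/ d; have hh : (C ^ (d - 1)).+1 <= h by rewrite leq_divRL ?(ltnW d1) // mulnC.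
have qh : q.+1 <= 2 * d * h.
  have := divn_lower q (ltnW d1); rewrite -/h; have : d <= d * h by rewrite leq_pmulr; lia.
  lia.
have hM : M * countE E k <= C * h.
  apply: leq_trans (_ : M * (q.+1 * (d * d).+1) <= _); first by rewrite leq_mul2l cE orbT.
  by rewrite [q.+1 * _]mulnC mulnA /C -!mulnA !leq_mul2l mulnA qh !orbT.
apply: leq_trans h1; apply: leq_trans (kappa_lower q d1); rewrite -/h.
apply: leq_trans (_ : (C * h) ^ (d - 1) <= _); first by rewrite leq_exp2r //; lia.
rewrite expnMn.
have -> : h ^ d = h * h ^ (d - 1) by rewrite -expnS; congr (_ ^ _); lia.
by rewrite leq_mul2r (ltnW hh) orbT.
Qed.

(** Failure means [2 * (k - kappa_ 2 q) <= s * q.+1 + 2], so at [k - 2] the budget no longer covers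
    [s] points of the layer. *)
Lemma flambda_not_attained2 (k : nat) : ~ attained 2 k ->
  flambda 2 (k - 2) < flambda 2 k.
Proof.
move=> /not_attained_dim2 [q [s [h1 hp -> s0 hr]]].
have /andP[_] := @kappa_p 2 k isT; rewrite hp => h2.
have [lt|ge] := ltnP (k - 2) (kappa_ 2 q).
  by apply: leq_ltn_trans (@flambda_leq_N 2 _ _ isT lt) _; rewrite -addn1 leq_add2l.
rewrite /flambda (@p_unique 2 (k - 2) q) // ?ge /=; last by lia.
rewrite ltn_add2l ltn_divLR //.
have [k2|k2] := leqP 2 k; first by lia.
have -> : k - 2 = 0 by lia.
by rewrite sub0n muln0 muln_gt0 s0.
Qed.

(** Each exception raises [flambda 2] over two steps; telescoping along both parities gives the two
    terms. *)
Lemma countE_flambda (E : pred nat) (k : nat) : (forall k, E k -> ~ attained 2 k) ->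
  countE E k <= flambda 2 k + flambda 2 k.-1.
Proof.
move=> hE; elim: k => // k IH; rewrite countE_S /=.
have h : flambda 2 k.-1 + E k.+1 <= flambda 2 k.+1.
  case: (boolP (E k.+1)) => [/hE /flambda_not_attained2|_].
    by rewrite subSS subn1 addn1.
  by rewrite addn0; apply: leq_flambda => //; lia.
lia.
Qed.

Lemma sparse_nat_dim2 (E : pred nat) : (forall k, E k -> ~ attained 2 k) ->
  forall M, exists K, forall k, K <= k -> (M * countE E k) ^ (2 - 1) <= k.
Proof.
(* Slope [2 / (8 * M)] gives [M * flambda 2 k <= M * N_ 2 (8 * M) + k / 4], and twice this is at
   most [k] beyond the threshold. *)
move=> hE M; exists (kappa_ 2 (8 * M) + 4 * M * N_ 2 (8 * M)) => k hk.
have hc := countE_flambda k hE.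
have := @leq_flambda 2 k.-1 k isT (leq_pred k).
have := @flambda_sublinear 2 k (8 * M) isT; rewrite subSS subn0 expn1.
move: (countE E k) (flambda 2 k) (flambda 2 k.-1) (N_ _ _) hc hk => c F F' N hc hk h1 h2.
have {}h1 : 8 * M * F <= 8 * M * N + 2 * k by apply: h1; lia.
have : M * c <= M * (F + F) by rewrite leq_mul2l; apply/orP; right; lia.
rewrite -!mulnA in h1 hk; rewrite mulnDr.
by move: (M * c) (M * F) (M * N) h1 hk => x y z; lia.
Qed.


(** * From integer inequalities to the real limit *)

Lemma INR_leq (m n : nat) : m <= n -> Rdefinitions.Rle (Raxioms.INR m) (Raxioms.INR n).
Proof. by move=> mn; apply: RIneq.le_INR; apply/ssrnat.leP. Qed.

Lemma INR_expn (m n : nat) : Raxioms.INR (m ^ n) = Rpow_def.pow (Raxioms.INR m) n.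
Proof. by elim: n => // n IH; rewrite expnS [LHS]RIneq.mult_INR IH. Qed.

Lemma leq_Rpower_inv (a k n : nat) : 0 < n -> 0 < k -> a ^ n <= k ->
  Rdefinitions.Rle (Raxioms.INR a)
    (Rpower.Rpower (Raxioms.INR k) (Rdefinitions.Rinv (Raxioms.INR n))).
Proof.
move=> n0 k0 h.
have nR : Raxioms.INR n <> Rdefinitions.R0 by apply: RIneq.not_0_INR; apply/eqP; rewrite -lt0n.
(* [Rpower] is always positive, which settles [a = 0]; writing [a] as the root of its power needs
   [a > 0]. *)
case: (posnP a) => [->|a0]; first by apply: RIneq.Rlt_le; apply: Exp_prop.exp_pos.
have aR : Rdefinitions.Rlt Rdefinitions.R0 (Raxioms.INR a) by apply/RIneq.lt_0_INR/ssrnat.ltP.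
have -> : Raxioms.INR a = Rpower.Rpower (Raxioms.INR (a ^ n)) (Rdefinitions.Rinv (Raxioms.INR n)).
  by rewrite INR_expn -Rpower.Rpower_pow // Rpower.Rpower_mult RIneq.Rinv_r // Rpower.Rpower_1.
apply: Rpower.Rle_Rpower_l.
  by apply/RIneq.Rlt_le/RIneq.Rinv_0_lt_compat/RIneq.lt_0_INR/ssrnat.ltP.
split; last exact: INR_leq.
by apply: RIneq.lt_0_INR; apply/ssrnat.ltP; rewrite expn_gt0 a0.
Qed.

Lemma sparse_nat (d : nat) (E : pred nat) : 1 < d ->
  (forall M, exists K, forall k, K <= k -> (M * countE E k) ^ (d - 1) <= k) ->
  sparse d E.
Proof.
move=> d1 H; apply/Lim_seq.is_lim_seq_spec => eps.
have [M [hM /ssrnat.ltP M0]] := Rtrigo_def.archimed_cor1 _ (RIneq.cond_pos eps).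
have [K hK] := H M; exists (maxn K 1) => k /ssrnat.leP; rewrite geq_max => /andP[/hK h k0].
have := leq_Rpower_inv _ k0 h; rewrite subn_gt0 => /(_ d1).
rewrite RIneq.mult_INR RIneq.Rminus_0_r; set r := Rpower.Rpower _ _ => hr.
have r0 : Rdefinitions.Rlt Rdefinitions.R0 r by apply: Exp_prop.exp_pos.
have M0R : Rdefinitions.Rlt Rdefinitions.R0 (Raxioms.INR M) by apply/RIneq.lt_0_INR/ssrnat.ltP.
rewrite Rbasic_fun.Rabs_pos_eq; last first.
  by apply: Rcomplements.Rdiv_le_0_compat => //; apply: RIneq.pos_INR.
apply: RIneq.Rle_lt_trans hM; apply/Rcomplements.Rle_div_l => //.
apply: (RIneq.Rmult_le_reg_l (Raxioms.INR M)) => //.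
by rewrite -Raxioms.Rmult_assoc RIneq.Rinv_r ?Raxioms.Rmult_1_l //; apply: RIneq.Rgt_not_eq.
Qed.

Theorem theorem1p2 (d : nat) (hd : (2 <= d)%N) :
  exists E : pred nat,
    [/\ (forall k, E k -> (0 < k)%N),
        (forall n, exists k, (n < k)%N /\ E k),
        sparse d E,
        (forall k, (0 < k)%N -> ~~ E k ->
           exists m : nat, is_delta_z d k m /\ (m%:Z = Num.floor (lambda d k))%R)
      & (forall k, E k ->
           exists m : nat, is_delta_z d k m /\ (m%:Z = Num.floor (lambda d k) - 1)%R)].
Proof.
(* Excluded middle turns [attained] into a boolean predicate. *)
pose E (k : nat) :=
  (0 < k) && ~~ ClassicalEpsilon.excluded_middle_informative (attained d k).
have EP k : 0 < k -> reflect (~ attained d k) (E k).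
  rewrite /E => ->; case: ClassicalEpsilon.excluded_middle_informative => h.
    by apply: ReflectF => /(_ h).
  exact: ReflectT.
have E0 k : E k -> 0 < k by case/andP.
have EN k : E k -> ~ attained d k by move=> /[dup] /E0 /EP h /h.
exists E; split=> // [n||k k0 /(EP k k0) nE|k Ek].
(* The choice [j = n + 2] ensures both [1 < j] and an exception beyond [n]. *)
- set j := n.+2; have dj : 0 < d * j by rewrite muln_gt0 (ltnW hd).
  have e : d * j = (d * j).-1.+1 by rewrite prednK.
  exists (kappa_ d (d * j).-1 + j); split; first by rewrite addnC /j; lia.
  apply/EP; first by rewrite /j; lia.
  have [_ hF] := @layer_gap d j _ hd isT e.
  by rewrite /attained hF; apply: layer_gap_not_attained.
- apply: sparse_nat => //; case: (ltngtP d 2) hd => // [d2|d2] _.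
    exact: sparse_nat_gt2.
  by move: EN; rewrite d2; apply: sparse_nat_dim2.
- have [X aX szX] : attained d k by apply: Classical_Prop.NNPP.
  exists (flambda d k); split; last by rewrite floor_lambda.
  by split; [exists X|move=> Y; apply: admissible_size].
have k0 := E0 k Ek; have F0 := flambda_gt0 hd k0.
have [X aX szX] := admissible_pred hd k0.
exists (flambda d k).-1; split; last by rewrite floor_lambda //; lia.
split; first by exists X.
move=> Y aY; rewrite -ltnS prednK // ltn_neqAle admissible_size // andbT.
by apply/eqP => szY; apply: (EN k Ek); exists Y.
Qed.
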